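(* Let $k,l$ be positive integers. There exists a strongly cancellative set $C$ on $D_l^k$ such that $|C| = l^{\lfloor k/2\rfloor}$.
   Context: $D_l^k$ is the lattice formed by the product of $k$ chains of length $l-1$ (each having $l$ elements): its points are the integer vectors $(v_1,\ldots,v_k)$ with $0\le v_i\le l-1$ for all $i$, ordered by $v\preceq w$ if and only if $v_i\le w_i$ for all $1\le i\le k$. Thus $\wedge$ and $\vee$ are the componentwise minimum and maximum, respectively. A strongly cancellative set of (or on) a lattice $L$ is a subset $C$ of the points of $L$ such that for any three different points $a_1,a_2,a_3\in C$, $a_1\wedge a_2\neq a_1\wedge a_3$ and $a_1\vee a_2\neq a_1\vee a_3$. *)

(* Defs.v *)
From mathcomp Require Import all_boot all_order.

Set Implicit Arguments.
Unset Strict Implicit.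
Unset Printing Implicit Defensive.

(* [k.-tupleprod 'I_l] is [k.-tuple 'I_l] with the product (componentwise)
   order of the natural orders on the chains ['I_l] = {0, ..., l - 1}. *)
Notation chain_prod l k := (k.-tupleprod 'I_l)%type.

Definition strongly_cancellative (d : Order.disp_t) (L : latticeType d)
    (C : {pred L}) : Prop :=
  forall a1 a2 a3 : L, a1 \in C -> a2 \in C -> a3 \in C ->
    a1 <> a2 -> a1 <> a3 -> a2 <> a3 ->
    Order.meet a1 a2 <> Order.meet a1 a3 /\
    Order.join a1 a2 <> Order.join a1 a3.

Lemma le_chain_prod (l k : nat) (v w : chain_prod l k) :
  (v <= w)%O = [forall i : 'I_k, (tnth v i <= tnth w i)%N].
Proof. by rewrite Order.TupleProdOrder.leEtprod. Qed.

Lemma meet_chain_prod (l k : nat) (v w : chain_prod l k) (i : 'I_k) :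
  tnth (Order.meet v w) i = minn (tnth v i) (tnth w i) :> nat.
Proof.
rewrite Order.TupleProdOrder.meetEtprod tnth_mktuple.
have [le_vw | lt_wv] := Order.TotalTheory.leP (tnth v i) (tnth w i).
  by rewrite (minn_idPl le_vw).
by rewrite (minn_idPr (ltnW lt_wv)).
Qed.

Lemma join_chain_prod (l k : nat) (v w : chain_prod l k) (i : 'I_k) :
  tnth (Order.join v w) i = maxn (tnth v i) (tnth w i) :> nat.
Proof.
rewrite Order.TupleProdOrder.joinEtprod tnth_mktuple.
have [le_vw | lt_wv] := Order.TotalTheory.leP (tnth v i) (tnth w i).
  by rewrite (maxn_idPr le_vw).
by rewrite (maxn_idPl (ltnW lt_wv)).
Qed.

(* Main.v *)
Require Import Defs.
From mathcomp Require Import all_boot all_order.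
From mathcomp Require Import zify.

(** In the product of two chains, the antichain of the points [(x, l - 1 - x)]
    has [l] elements, and the meet of the points of parameters [x] and [y] is
    [(min x y, l - 1 - max x y)].  It therefore determines both [min x y] and
    [max x y], so that [y] can be recovered from it once [x] is known; the join
    does so too, with the roles of [min] and [max] exchanged.

    This recovery works coordinate by coordinate, so it survives products.  The
    set [C] is the product of [k %/ 2] copies of this antichain, one for each
    pair of consecutive coordinates, the last coordinate being [0] when [k] is
    odd.  On [C] both the meet and the join with a given point of [C] are
    injective maps, which gives strong cancellativity. *)

(** Since [minn x y + maxn x y = x + y], the values of [minn x] and [maxn x]
    at [y] determine [y]; the reflection [x |-> n - x] turns [maxn] into
    [minn]. *)
Lemma minn_rev_cancel (n x y z : nat) : y <= n -> z <= n ->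
  minn x y = minn x z -> minn (n - x) (n - y) = minn (n - x) (n - z) -> y = z.
Proof. lia. Qed.

Lemma maxn_rev_cancel (n x y z : nat) : y <= n -> z <= n ->
  maxn x y = maxn x z -> maxn (n - x) (n - y) = maxn (n - x) (n - z) -> y = z.
Proof. lia. Qed.

Definition antichain_point {k l : nat} (hl : 0 < l)
    (x : {ffun 'I_(k %/ 2) -> 'I_l}) : chain_prod l k :=
  [tuple if insub (i %/ 2) is Some j
         then if odd i then rev_ord (x j) else x j
         else Ordinal hl | i < k].

Lemma antichain_point_coords {k l : nat} (hl : 0 < l) (j : 'I_(k %/ 2)) :
  exists p q : 'I_k, forall x : {ffun 'I_(k %/ 2) -> 'I_l},
    tnth (antichain_point hl x) p = x j :> nat /\
    tnth (antichain_point hl x) q = l.-1 - x j :> nat.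
Proof.
have lt_p : j * 2 < k by have := ltn_ord j; lia.
have lt_q : (j * 2).+1 < k by have := ltn_ord j; lia.
exists (Ordinal lt_p), (Ordinal lt_q) => x.
rewrite !tnth_mktuple /= muln2 odd_double /=.
have -> : j.*2 %/ 2 = j by lia.
have -> : j.*2.+1 %/ 2 = j by lia.
by rewrite valK /=; split=> //; lia.
Qed.

Lemma antichain_point_inj {k l : nat} (hl : 0 < l) :
  injective (@antichain_point k l hl).
Proof.
move=> x y eq_xy; apply/ffunP => j; apply: val_inj => /=.
have [p [q coords]] := antichain_point_coords hl j.
by rewrite -(coords x).1 -(coords y).1 eq_xy.
Qed.

Lemma antichain_point_meet_inj {k l : nat} (hl : 0 < l)
    (x y z : {ffun 'I_(k %/ 2) -> 'I_l}) :
  Order.meet (antichain_point hl x) (antichain_point hl y) =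
    Order.meet (antichain_point hl x) (antichain_point hl z) ->
  y = z.
Proof.
move=> eq_meet; apply/ffunP => j; apply: val_inj => /=.
have [p [q coords]] := antichain_point_coords hl j.
have := congr1 (fun v : chain_prod l k => tnth v q : nat) eq_meet.
have := congr1 (fun v : chain_prod l k => tnth v p : nat) eq_meet.
rewrite /= !meet_chain_prod.
rewrite !(coords x).1 !(coords y).1 !(coords z).1.
rewrite !(coords x).2 !(coords y).2 !(coords z).2.
by apply: minn_rev_cancel; rewrite -ltnS prednK.
Qed.

Lemma antichain_point_join_inj {k l : nat} (hl : 0 < l)
    (x y z : {ffun 'I_(k %/ 2) -> 'I_l}) :
  Order.join (antichain_point hl x) (antichain_point hl y) =
    Order.join (antichain_point hl x) (antichain_point hl z) ->
  y = z.
Proof.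
move=> eq_join; apply/ffunP => j; apply: val_inj => /=.
have [p [q coords]] := antichain_point_coords hl j.
have := congr1 (fun v : chain_prod l k => tnth v q : nat) eq_join.
have := congr1 (fun v : chain_prod l k => tnth v p : nat) eq_join.
rewrite /= !join_chain_prod.
rewrite !(coords x).1 !(coords y).1 !(coords z).1.
rewrite !(coords x).2 !(coords y).2 !(coords z).2.
by apply: maxn_rev_cancel; rewrite -ltnS prednK.
Qed.

Theorem corollary5p3 (k l : nat) (hk : 0 < k) (hl : 0 < l) :
  exists C : {set chain_prod l k},
    strongly_cancellative C /\ #|C| = l ^ (k %/ 2).
Proof.
exists [set antichain_point hl x | x : {ffun 'I_(k %/ 2) -> 'I_l}]; split.
  move=> _ _ _ /imsetP[x _ ->] /imsetP[y _ ->] /imsetP[z _ ->] _ _ neq_yz.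
  split=> [/antichain_point_meet_inj eq_yz | /antichain_point_join_inj eq_yz];
    by rewrite eq_yz in neq_yz.
by rewrite (card_imset _ (antichain_point_inj hl)) card_ffun !card_ord.
Qed.
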